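(* Let $\Delta$ be the root system of type $A_n$ (of $\mathfrak{sl}_{n+1}$) with simple roots $\alpha_i=\varepsilon_i-\varepsilon_{i+1}$, $i=1,\dots,n$. Identify every positive root $\alpha_i+\alpha_{i+1}+\dots+\alpha_j$ ($i\le j$) with its support, the interval $[i,j]=\{i,i+1,\dots,j\}\subseteq[n]=\{1,\dots,n\}$. Define $\Phi:\mathrm{Ab}(\mathfrak{sl}_{n+1})\to 2^{[n]}$ by \[ \Phi(I)=\mathrm{supp}(\gamma_1)\oplus\cdots\oplus\mathrm{supp}(\gamma_k), \] where $\gamma_1,\dots,\gamma_k$ are the generators of $I$ and $\oplus$ denotes symmetric difference of subsets of $[n]$ (with $\Phi(\varnothing)=\varnothing$). Then $\Phi$ is a bijection between $\mathrm{Ab}(\mathfrak{sl}_{n+1})$ and the set $2^{[n]}$ of all subsets of $[n]$. Moreover, if $I$ has $k$ generators, then $\Phi(I)$ has $k$ connected components (i.e. is a disjoint union of exactly $k$ maximal intervals of consecutive integers).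
   Context: $\Delta^+$ is partially ordered by the root order: $\nu\preccurlyeq\mu$ iff $\mu-\nu$ is a non-negative integral combination of simple roots. $\mathrm{Ab}(\mathfrak{sl}_{n+1})$ denotes the set of subsets $I\subseteq\Delta^+$ that are upper ideals (if $\nu\in I$, $\gamma\in\Delta^+$, $\nu\preccurlyeq\gamma$ then $\gamma\in I$) and satisfy $\gamma'+\gamma''\notin\Delta^+$ for all $\gamma',\gamma''\in I$; these correspond to the abelian ideals of a Borel subalgebra. The generators of $I$ are its minimal elements. The connected components of a subset of $[n]$ are taken with respect to the path graph $1-2-\cdots-n$ (the Dynkin diagram of $A_n$). *)

(* Defs.v *)
From HB Require Import structures.
From mathcomp Require Import all_boot all_order all_algebra.
From mathcomp Require Import finmap boolp.

Set Implicit Arguments.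
Unset Strict Implicit.
Unset Printing Implicit Defensive.

Import GRing.Theory.

Local Open Scope ring_scope.

(* The nodes 1, ..., n of the Dynkin diagram are represented by 'I_n, that is
   by 0, ..., n-1, and eps_1, ..., eps_{n+1} by the canonical basis of
   Z^{n+1}. *)
Definition eps n (i : 'I_n.+1) : 'rV[int]_n.+1 := delta_mx 0 i.

Definition simple_root n (k : 'I_n) : 'rV[int]_n.+1 :=
  eps (widen_ord (leqnSn n) k) - eps (lift ord0 k).

Definition root_system n : {fset 'rV[int]_n.+1} :=
  [fset eps p.1 - eps p.2 | p in [pred p : 'I_n.+1 * 'I_n.+1 | p.1 != p.2]]%fset.

Definition root_le n (nu mu : 'rV[int]_n.+1) : bool :=
  `[< exists c : 'I_n -> nat, mu - nu = \sum_k simple_root k *+ c k >].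

Definition pos_roots n : {fset 'rV[int]_n.+1} :=
  [fset g in root_system n | root_le 0 g]%fset.

(* The c k are unique, the simple roots being linearly independent. *)
Definition supp n (g : 'rV[int]_n.+1) : {set 'I_n} :=
  [set k | `[< exists2 c : 'I_n -> int,
                 g = \sum_l simple_root l *~ c l & c k != 0 >]].

Definition upper_ideal n (I : {set pos_roots n}) : bool :=
  [forall nu in I, forall g : pos_roots n,
     root_le (val nu) (val g) ==> (g \in I)].

Definition abelian_ideal n (I : {set pos_roots n}) : bool :=
  upper_ideal I &&
  [forall g1 in I, forall g2 in I, val g1 + val g2 \notin pos_roots n].

Definition Ab n := {I : {set pos_roots n} | abelian_ideal I}.

Definition generators n (I : {set pos_roots n}) : {set pos_roots n} :=
  [set g in I | [forall nu in I, root_le (val nu) (val g) ==> (nu == g)]].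

Section SymmetricDifference.
Variable T : finType.
Implicit Types A B C : {set T}.

Definition symdiff A B : {set T} := (A :\: B) :|: (B :\: A).

Fact symdiffA : associative symdiff.
Proof.
move=> A B C; apply/setP=> x; rewrite !inE.
by case: (x \in A); case: (x \in B); case: (x \in C).
Qed.

Fact symdiffC : commutative symdiff.
Proof. by move=> A B; rewrite /symdiff setUC. Qed.

Fact symdiff0 : left_id set0 symdiff.
Proof. by move=> A; rewrite /symdiff set0D setD0 set0U. Qed.

HB.instance Definition _ :=
  Monoid.isComLaw.Build {set T} set0 symdiff symdiffA symdiffC symdiff0.
End SymmetricDifference.

Definition Phi n (I : Ab n) : {set 'I_n} :=
  \big[@symdiff 'I_n/set0]_(g in generators (val I)) supp (val g).

Definition path_edge n (i j : 'I_n) : bool :=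
  (j == i.+1 :> nat) || (i == j.+1 :> nat).

Definition components n (S : {set 'I_n}) : {set {set 'I_n}} :=
  equivalence_partition
    (connect [rel i j | [&& i \in S, j \in S & path_edge i j]]) S.

(* Main.v *)
(* Write a positive root as [eps a - eps b] with [a < b], so that its support
   is [{k | a <= k < b}] and the root order is inclusion of intervals; call [a]
   and [b] the endpoints [lo g] and [hi g] of this root [g]. An upper ideal is
   abelian iff [lo g < hi h] for all of its elements [g] and [h], which need
   only be checked on generators. So if [I] has [k] generators, the
   set [E] of their endpoints has [2k] elements, the [k] smallest being left
   ends and the [k] largest right ends, and the antichain condition forces the
   i-th left end to be paired with the i-th right end: [E] determines [I], and
   every set with an even number of elements arises. On the other hand [Phi I]
   consists of the nodes [x] with an odd number of [e <= x] in [E], so [E] is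
   the set of places where membership in [Phi I] changes. Subsets of the
   Dynkin diagram correspond to their even boundaries, and a subset has half
   as many components as boundary points. *)
From HB Require Import structures.
Require Import Defs.
From mathcomp Require Import all_boot all_algebra.
From mathcomp Require Import finmap boolp zify.

Set Implicit Arguments.
Unset Strict Implicit.
Unset Printing Implicit Defensive.

Import GRing.Theory Num.Theory.

(** * Roots of type A as intervals: coefficients, root order, supports *)

Section Roots.
Variable n : nat.
Local Open Scope ring_scope.
Implicit Types (v w : 'rV[int]_n.+1) (a b c d : 'I_n.+1) (k l : 'I_n).

(* The coefficient of the simple root [m] in [v], when the latter lies in the
   root lattice, i.e. when [psum n v = 0]. *)
Definition psum (m : nat) v : int := \sum_(i < n.+1 | (i <= m)%N) v 0 i.

Fact psum_is_zmod_morphism m : zmod_morphism (psum m).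
Proof.
by move=> v w; rewrite /psum -sumrB; apply: eq_bigr => i _; rewrite !mxE.
Qed.
HB.instance Definition _ m :=
  GRing.isZmodMorphism.Build _ _ (psum m) (psum_is_zmod_morphism m).

Lemma psum_eps m a : psum m (eps a) = (a <= m)%N%:R.
Proof.
rewrite /psum /eps; under eq_bigr => i _ do rewrite mxE eqxx /=.
have [am | am] := leqP.
  by rewrite (bigD1 a) //= eqxx big1 // => i /andP[_ /negPf ->].
by rewrite big1 // => i im; case: eqP => // ia; move: im; rewrite ia leqNgt am.
Qed.

Lemma psum_root m a b :
  (a <= b)%N -> psum m (eps a - eps b) = (a <= m < b)%N%:R.
Proof. by move=> ab; rewrite raddfB /= !psum_eps; lia. Qed.

Lemma psum_simple_root m k : psum m (simple_root k) = (m == k :> nat)%:R.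
Proof. by rewrite psum_root /= /bump; lia. Qed.

Lemma psum_comb m (c : 'I_n -> int) :
  psum m (\sum_l simple_root l *~ c l) = \sum_(l < n) (m == l :> nat)%:R *~ c l.
Proof.
by rewrite raddf_sum; apply: eq_bigr => l _; rewrite raddfMz /= psum_simple_root.
Qed.

Lemma psum_comb_ord k (c : 'I_n -> int) :
  psum k (\sum_l simple_root l *~ c l) = c k.
Proof.
rewrite psum_comb (bigD1 k) //= eqxx intz big1 ?addr0 // => l /negPf lk.
by rewrite eq_sym val_eqE lk mul0rz.
Qed.

Lemma psum_inj v w : (forall m, (m <= n)%N -> psum m v = psum m w) -> v = w.
Proof.
move=> vw; apply/rowP => i; pose d := v - w.
have d0 m : (m <= n)%N -> psum m d = 0 by move=> mn; rewrite raddfB /= vw ?subrr.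
suff: d 0 i = 0 by rewrite !mxE => /eqP; rewrite subr_eq0 => /eqP.
have := d0 i (ltn_ord i); rewrite /psum (bigD1 i) //=.
(* A coordinate is the difference of two consecutive partial sums, except the first, which is itself
   a partial sum. *)
case: (posnP i) => [i0|i_gt0].
  rewrite big1 ?addr0 // => j; rewrite -val_eqE /=; lia.
have in1 : (i.-1 <= n)%N by have := ltn_ord i; lia.
rewrite (eq_bigl (fun j : 'I_n.+1 => j <= i.-1)%N) => [|j].
  by rewrite -/(psum i.-1 d) d0 // addr0.
rewrite -val_eqE /=; lia.
Qed.

Lemma simple_root_decomp v :
  psum n v = 0 -> v = \sum_k simple_root k *~ psum k v.
Proof.
move=> vn; apply: psum_inj => m; rewrite leq_eqVlt => /predU1P[->|mn].
  rewrite psum_comb vn big1 // => k _.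
  by rewrite (gtn_eqF (ltn_ord k)) mul0rz.
exact/esym/(psum_comb_ord (Ordinal mn) (fun k => psum k v)).
Qed.

Lemma mem_supp k v : psum n v = 0 -> (k \in supp v) = (psum k v != 0).
Proof.
move=> vn; rewrite inE; apply/asboolP/idP => [[c -> ck]|vk].
  by rewrite psum_comb_ord.
by exists (fun l => psum l v) => //; apply: simple_root_decomp.
Qed.

(** In the root lattice the coefficients on simple roots are the partial sums, so the root order is
    their pointwise comparison. *)
Lemma root_leP v w : psum n v = 0 -> psum n w = 0 ->
  reflect (forall m, (m < n)%N -> psum m v <= psum m w) (root_le v w).
Proof.
move=> vn wn; apply: (iffP (asboolP _)) => [[c cE] m mn|vw].
  rewrite -subr_ge0 -raddfB /= cE.
  by have /= -> := psum_comb_ord (Ordinal mn) (fun k => c k).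
exists (fun k => `|psum k (w - v)|%N).
rewrite {1}(@simple_root_decomp (w - v)) ?raddfB /= ?vn ?wn ?subrr //.
apply: eq_bigr => k _; rewrite -{1}[psum k _]gez0_abs //.
by rewrite raddfB subr_ge0 vw.
Qed.

Lemma psum_last a b : psum n (eps a - eps b) = 0.
Proof. by rewrite raddfB /= !psum_eps !leq_ord subrr. Qed.

Lemma root_le_eps a b c d : (a < b)%N -> (c < d)%N ->
  root_le (eps a - eps b) (eps c - eps d) = (c <= a)%N && (b <= d)%N.
Proof.
move=> ab cd; have bn := ltn_ord b.
have psumE m := (psum_root m (ltnW ab), psum_root m (ltnW cd)).
apply/(root_leP (psum_last _ _) (psum_last _ _))/idP => [le_ab_cd|cabd m _].
  (* Inclusion of intervals is detected at the first and last nodes, [a] and [b.-1], of the smaller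
     one. *)
  have := le_ab_cd a; have := le_ab_cd b.-1; rewrite !psumE; lia.
by rewrite !psumE; lia.
Qed.

Lemma pos_rootsP v :
  reflect (exists a b, (a < b)%N /\ v = eps a - eps b) (v \in pos_roots n).
Proof.
have le0P a b := root_leP (raddf0 (psum n)) (psum_last a b).
rewrite !inE; apply: (iffP andP) => [[/imfsetP[[a b] /= nab ->]]|].
  move=> /le0P le0; exists a, b; split=> //.
  have {nab}: a != b by []; rewrite -val_eqE /=.
  case: (ltngtP a b) => // ba _; have an := ltn_ord a.
  (* For [b < a] the coefficient at [b] would be -1. *)
  by have := le0 b; rewrite raddf0 raddfB /= !psum_eps; lia.
move=> [a [b [ab ->]]]; split.
  by apply/imfsetP; exists (a, b) => //; rewrite unfold_in /= neq_ltn ab.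
by apply/le0P => m _; rewrite raddf0 (psum_root _ (ltnW ab)) ler0n.
Qed.

Lemma supp_eps k a b :
  (a < b)%N -> (k \in supp (eps a - eps b)) = (a <= k < b)%N.
Proof.
move=> ab; rewrite (mem_supp _ (psum_last _ _)) (psum_root _ (ltnW ab)).
by rewrite pnatr_eq0 eqb0 negbK.
Qed.

Fact pos_root_spec (g : pos_roots n) :
  {p : 'I_n.+1 * 'I_n.+1 | (p.1 < p.2)%N & val g = eps p.1 - eps p.2}.
Proof.
suff /sig2W[p]: exists2 p : 'I_n.+1 * 'I_n.+1,
  (p.1 < p.2)%N & val g == eps p.1 - eps p.2 by move=> ? /eqP; exists p.
by have /pos_rootsP[a [b [ab ->]]] := valP g; exists (a, b).
Qed.

Definition lo (g : pos_roots n) : 'I_n.+1 := (s2val (pos_root_spec g)).1.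
Definition hi (g : pos_roots n) : 'I_n.+1 := (s2val (pos_root_spec g)).2.
Implicit Types g h : pos_roots n.

Lemma val_pos_root g : val g = eps (lo g) - eps (hi g).
Proof. by rewrite /lo /hi; case: pos_root_spec. Qed.

Lemma ltn_lo_hi g : (lo g < hi g)%N.
Proof. by rewrite /lo /hi; case: pos_root_spec. Qed.

Lemma lo_hi_inj g h : lo g = lo h -> hi g = hi h -> g = h.
Proof. by move=> el eh; apply: val_inj; rewrite !val_pos_root el eh. Qed.

Lemma root_leE g h :
  root_le (val g) (val h) = (lo h <= lo g)%N && (hi g <= hi h)%N.
Proof. by rewrite !val_pos_root root_le_eps ?ltn_lo_hi. Qed.

Lemma in_supp k g : (k \in supp (val g)) = (lo g <= k < hi g)%N.
Proof. by rewrite val_pos_root supp_eps ?ltn_lo_hi. Qed.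

Lemma ex_pos_root a b : (a < b)%N -> exists2 g, lo g = a & hi g = b.
Proof.
move=> ab.
have abP : eps a - eps b \in pos_roots n by apply/pos_rootsP; exists a, b.
pose g := Sub (eps a - eps b) abP : pos_roots n.
(* [lo] and [hi] come from a choice; comparing the root with itself in both directions forces them
   to be [a] and [b]. *)
have leg : root_le (val g) (eps a - eps b) && root_le (eps a - eps b) (val g).
  by rewrite /= !root_le_eps // !leqnn.
move: leg; rewrite {1 2}val_pos_root !root_le_eps ?ltn_lo_hi // => leg.
by exists g; apply: val_inj => /=; lia.
Qed.

Lemma pos_rootD g h : lo g = hi h -> val g + val h \in pos_roots n.
Proof.
move=> E; apply/pos_rootsP; exists (lo h), (hi g); split.
  by rewrite (ltn_trans (ltn_lo_hi h)) // -E ltn_lo_hi.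
by rewrite !val_pos_root -E addrC addrA subrK.
Qed.

(** At the larger of the two left ends both roots have coefficient 1, so their sum has coefficient 2
    there, whereas a positive root only has coefficients 0 and 1. *)
Lemma overlap_pos_rootD g h :
  (lo g < hi h)%N -> (lo h < hi g)%N -> val g + val h \notin pos_roots n.
Proof.
move=> gh hg; have lg := ltn_lo_hi g; have lh := ltn_lo_hi h.
apply/negP => /pos_rootsP[a [b [ab /(congr1 (psum (maxn (lo g) (lo h))))]]].
rewrite !val_pos_root raddfD /= (psum_root _ (ltnW ab)).
by rewrite (psum_root _ (ltnW lg)) (psum_root _ (ltnW lh)); lia.
Qed.
End Roots.

Arguments lo {n} g.
Arguments hi {n} g.

Lemma in_bigsymdiff (T J : finType) (A : {set J}) (F : J -> {set T}) x :
  (x \in \big[@symdiff T/set0]_(j in A) F j) =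
  \big[addb/false]_(j in A) (x \in F j).
Proof.
apply: (big_morph (fun B : {set T} => x \in B)); last by rewrite inE.
by move=> B C; rewrite !inE; case: (x \in B); case: (x \in C).
Qed.

(** * Subsets of the path and their even boundaries *)

Section Boundary.
Variable n : nat.
Implicit Types (E : {set 'I_n.+1}) (S : {set 'I_n}) (m : nat).

Definition parity E m : bool := \big[addb/false]_(e in E) (e <= m).

Lemma parity_odd E m : n <= m -> parity E m = odd #|E|.
Proof.
move=> nm; rewrite -sum1_card (big_morph odd oddD (erefl _)).
by apply: eq_bigr => e _; rewrite (leq_trans (leq_ord e)).
Qed.

(** Passing from [e.-1] to [e], only the point [e] itself can change the count. The guard [0 < e] is
    needed because [0.-1] is [0]: the parity before the first point is even. *)
Lemma mem_parity E (e : 'I_n.+1) :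
  (e \in E) = parity E e (+) ((0 < e) && parity E e.-1).
Proof.
have -> : (0 < e) && parity E e.-1 = \big[addb/false]_(x in E) (x < e).
  have [e0|e_gt0] := posnP e; first by rewrite e0 big1.
  by apply: eq_bigr => x _; rewrite -ltnS prednK.
rewrite -big_split /= (eq_bigr (fun x => x == e)) => [|x _]; last first.
  by rewrite -val_eqE /=; case: ltngtP.
have [eE|eE] := boolP (e \in E).
  by rewrite (bigD1 e) //= eqxx big1 // => x /andP[_ /negPf].
by rewrite big1 // => x xE; apply: contraNF eE => /eqP <-.
Qed.

(** Taking [m] in [nat] allows the test at the point [n], which is a boundary position but not a
    node. *)
Definition node_in S m : bool := [exists k in S, k == m :> nat].

Lemma node_in_ord S (k : 'I_n) : node_in S k = (k \in S).
Proof.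
apply/exists_inP/idP => [[l lS /eqP/val_inj <-] //|kS].
by exists k.
Qed.

Lemma node_in_geq S m : n <= m -> node_in S m = false.
Proof.
move=> nm; apply/exists_inP => -[k _ /eqP km].
by have := ltn_ord k; rewrite km ltnNge nm.
Qed.

Definition boundary S : {set 'I_n.+1} :=
  [set e : 'I_n.+1 | node_in S e (+) ((0 < e) && node_in S e.-1)].

(** [boundary] is the discrete derivative modulo 2 and [parity] the summation that inverts it. *)
Lemma parity_boundary S m : m <= n -> parity (boundary S) m = node_in S m.
Proof.
elim: m => [|m IHm] mn.
  by have := mem_parity (boundary S) ord0; rewrite inE /= !addbF.
have := mem_parity (boundary S) (Ordinal (mn : m.+1 < n.+1)).
by rewrite inE /= IHm 1?ltnW // => /addIb.
Qed.

Lemma even_boundary S : ~~ odd #|boundary S|.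
Proof. by rewrite -(@parity_odd _ n) // parity_boundary // node_in_geq. Qed.

Lemma boundary_parity E :
  ~~ odd #|E| -> boundary [set k : 'I_n | parity E k] = E.
Proof.
move=> evenE; set S := [set k | _].
have inS m : m <= n -> node_in S m = parity E m.
  rewrite leq_eqVlt => /predU1P[->|mn].
    (* Evenness is what makes the parity vanish at [n], where there is no node. *)
    by rewrite node_in_geq // parity_odd // (negPf evenE).
  by rewrite (node_in_ord S (Ordinal mn)) inE.
apply/setP => e; rewrite inE mem_parity !inS // ?leq_ord //.
exact: leq_trans (leq_pred _) (leq_ord e).
Qed.

(** * Position of a point in a finite set, counted from 0 *)

Definition rank E m : nat := #|[set e in E | e < m]|.

Lemma leq_rank E m1 m2 : m1 <= m2 -> rank E m1 <= rank E m2.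
Proof.
move=> m12; apply/subset_leq_card/subsetP => e; rewrite !inE => /andP[->] /=.
by move=> em; apply: leq_trans m12.
Qed.

Lemma ltn_rank E (e : 'I_n.+1) m : e \in E -> e < m -> rank E e < rank E m.
Proof.
move=> eE em; apply/proper_card/properP; split.
  apply/subsetP => x; rewrite !inE => /andP[->] /= /ltn_trans; exact.
by exists e; rewrite !inE eE ?ltnn.
Qed.

Lemma rank_ltn_card E (e : 'I_n.+1) : e \in E -> rank E e < #|E|.
Proof.
move=> eE; apply: leq_trans (ltn_rank eE (ltnSn e)) _.
by apply/subset_leq_card/subsetP => x; rewrite inE => /andP[].
Qed.

Lemma ltn_rankE E (e : 'I_n.+1) m : e \in E -> (rank E e < rank E m) = (e < m).
Proof.
move=> eE; apply/idP/idP; last exact: ltn_rank.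
by apply: contraTT; rewrite -!leqNgt; apply: leq_rank.
Qed.

Lemma rank_inj E : {in E &, injective (fun e : 'I_n.+1 => rank E e)}.
Proof.
move=> e f eE fE /eqP; apply: contraTeq; rewrite -val_eqE /= !neq_ltn.
by rewrite !ltn_rankE.
Qed.

(** Pigeonhole: the rank is injective from [E] to the [#|E|] numbers below [#|E|], hence onto. *)
Lemma ex_rank E r : r < #|E| -> exists2 e, e \in E & rank E e = r.
Proof.
move=> rE; pose f (e : 'I_n.+1) : 'I_#|E|.-1.+1 := inord (rank E e).
have E_gt0 : 0 < #|E| by apply: leq_ltn_trans rE.
have fE e : e \in E -> f e = rank E e :> nat.
  by move=> eE; rewrite inordK // prednK // rank_ltn_card.
have f_inj : {in E &, injective f}.
  by move=> e1 e2 e1E e2E /(congr1 val); rewrite /= !fE //; apply: rank_inj.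
have /eqP fET : f @: E == setT.
  by rewrite eqEcard subsetT cardsT card_ord (card_in_imset f_inj) prednK /=.
have /imsetP[e eE /(congr1 val)] : inord r \in f @: E by rewrite fET.
by rewrite /= fE // inordK ?prednK // => ->; exists e.
Qed.
End Boundary.

(** * Counting connected components by their left ends *)

Section Components.
Variable n : nat.
Implicit Types (S : {set 'I_n}) (k l : 'I_n).

Definition left_ends S := [set k in S | ~~ ((0 < k) && node_in S k.-1)].

Let adj S := [rel i j : 'I_n | [&& i \in S, j \in S & path_edge i j]].

Lemma adj_sym S : connect_sym (adj S).
Proof.
apply: sym_connect_sym => i j /=.
by rewrite /path_edge orbC andbCA.
Qed.

(** Walk to the left inside [S] until the preceding node is missing. *)
Lemma ex_left_end S k :
  k \in S -> exists2 l, l \in left_ends S & connect (adj S) l k.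
Proof.
have [m] := ubnP (k : nat); elim: m k => // m IHm k km kS.
have [kleft|] := boolP (k \in left_ends S); first by exists k.
rewrite inE kS /= negbK => /andP[k0 /exists_inP[j jS /eqP jk]].
have [|l ll lj] := IHm j _ jS; first by lia.
exists l => //; apply: connect_trans lj _; apply: connect1.
by rewrite /= jS kS /path_edge jk prednK // eqxx.
Qed.

Lemma left_end_connect_leq S k l :
  l \in left_ends S -> connect (adj S) k l -> l <= k.
Proof.
rewrite inE => /andP[lS l_left] kl; rewrite leqNgt; apply/negP => kltl.
(* No path in [S] crosses to the left of [l]: the only edge that could is the one from [l.-1], which
   is not in [S]. *)
have closed_lt : closed (adj S) [pred j : 'I_n | j < l].
  apply: (intro_closed (adj_sym S)) => i j /and3P[iS jS ij]; rewrite !inE => il.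
  rewrite ltn_neqAle andbC; move: ij; rewrite /path_edge => ij.
  rewrite (_ : j <= l)%N /=; last by lia.
  apply: contra l_left => /eqP jl; apply/andP; split; first by lia.
  by apply/exists_inP; exists i => //; lia.
by have := closed_connect closed_lt kl; rewrite !inE kltl ltnn.
Qed.

(** The left ends are a transversal of the components: two of them in one component are each at most
    the other. *)
Lemma card_components S : #|components S| = #|left_ends S|.
Proof.
have eqvR : {in S & &, equivalence_rel (connect (adj S))}.
  move=> x y z _ _ _; split=> [|xy]; first exact: connect0.
  exact: same_connect (adj_sym S) _ _ xy z.
have partS := equivalence_partitionP eqvR.
rewrite -(@card_transversal _ (left_ends S) _ S) // /is_transversal partS /=.
apply/andP; split; first by apply/subsetP => k; rewrite inE => /andP[].
apply/forall_inP => B /imsetP[k kS ->].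
have [l ll lk] := ex_left_end kS.
apply/cards1P; exists l; apply/setP => j; rewrite in_set1 in_setI.
apply/andP/eqP => [[jl]|->]; last first.
  by split=> //; move: ll; rewrite !inE adj_sym lk andbT => /andP[].
rewrite inE => /andP[_ kj]; have lj := connect_trans lk kj.
apply/val_inj/eqP; rewrite eqn_leq (left_end_connect_leq jl) //.
by rewrite (left_end_connect_leq ll) // adj_sym.
Qed.

(** The boundary is the symmetric difference of [S] and its shift by one. These have equal size, so
    the two differences do too, and the points of [S] outside the shift are the left ends. *)
Lemma card_boundary S : #|boundary S| = (#|left_ends S|).*2.
Proof.
pose up k : 'I_n.+1 := lift ord0 k; pose same k := widen_ord (leqnSn n) k.
have up_inj : injective up by exact: lift_inj.
have same_inj : injective same by move=> i j /(congr1 val) ij; apply: val_inj.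
have in_same e : (e \in same @: S) = node_in S e.
  apply/imsetP/exists_inP => -[k kS] => [->|/eqP ke]; exists k => //.
  exact: val_inj.
have in_up e : (e \in up @: S) = (0 < e) && node_in S e.-1.
  apply/imsetP/andP => [[k kS ->]|[e0 /exists_inP[k kS /eqP ke]]].
    by split=> //; apply/exists_inP; exists k.
  by exists k => //; apply: val_inj; rewrite /= /bump ke; lia.
have -> : boundary S = (same @: S :\: up @: S) :|: (up @: S :\: same @: S).
  apply/setP => e; rewrite [LHS]inE in_setU !in_setD in_same in_up.
  by case: (node_in S e); case: (_ && _).
have -> : #|left_ends S| = #|same @: S :\: up @: S|.
  rewrite -(card_imset _ same_inj); apply: eq_card => e.
  rewrite in_setD in_up; apply/imsetP/andP => [[k + ->]|[eup /imsetP[k kS ek]]].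
    by rewrite inE /= => /andP[kS ->]; rewrite imset_f.
  by exists k => //; move: eup; rewrite inE kS ek.
have card_up : #|up @: S| = #|same @: S| by rewrite !card_imset.
rewrite cardsU (_ : _ :&: _ = set0); last first.
  by apply/setP => e; rewrite !inE; case: (_ \in _); case: (_ \in _).
by rewrite cards0 subn0 !cardsD card_up (setIC (up @: S)) addnn.
Qed.
End Components.

(** * Upper ideals, abelian ideals and their generators *)

Section Ideals.
Variable n : nat.
Implicit Types (g h l : pos_roots n) (G I : {set pos_roots n}).
Implicit Types (E : {set 'I_n.+1}) (S : {set 'I_n}).

Lemma root_le_refl g : root_le (val g) (val g).
Proof. by rewrite root_leE !leqnn. Qed.

Lemma root_le_trans g h l :
  root_le (val g) (val h) -> root_le (val h) (val l) -> root_le (val g) (val l).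
Proof. by rewrite !root_leE; lia. Qed.

Lemma root_le_anti g h :
  root_le (val g) (val h) -> root_le (val h) (val g) -> g = h.
Proof.
by rewrite !root_leE => gh hg; apply: lo_hi_inj; apply: val_inj => /=; lia.
Qed.

Definition crossing G := {in G &, forall g h, lo g < hi h}.

Definition antichain G :=
  {in G &, forall g h, root_le (val g) (val h) -> g = h}.

Lemma upper_idealP I :
  reflect (forall g h, g \in I -> root_le (val g) (val h) -> h \in I)
          (upper_ideal I).
Proof.
apply: (iffP forall_inP) => [up g h gI gh|up g gI].
  by have /forallP/(_ h) := up g gI; rewrite gh.
by apply/forallP => h; apply/implyP; apply: up gI.
Qed.

(* If [hi h <= lo g], widening [h] up to [lo g] stays in the upper ideal [I]
   and gives a root adjacent to [g]. *)
Lemma abelian_idealE I :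
  upper_ideal I -> reflect (crossing I) (abelian_ideal I).
Proof.
rewrite /abelian_ideal => /[dup] upI ->; move/upper_idealP: upI => upI.
apply: (iffP forall_inP) => [ab g h gI hI|crI g gI].
  rewrite ltnNge; apply/negP => hg.
  have [l ll lg] := ex_pos_root (leq_trans (ltn_lo_hi h) hg).
  have lI : l \in I by apply: upI hI _; rewrite root_leE ll lg leqnn.
  by have /forall_inP/(_ l lI) := ab g gI; rewrite pos_rootD.
by apply/forall_inP => h hI; apply: overlap_pos_rootD; apply: crI.
Qed.

Definition upset G : {set pos_roots n} :=
  [set h : pos_roots n | [exists g in G, root_le (val g) (val h)]].

Lemma upper_ideal_upset G : upper_ideal (upset G).
Proof.
apply/upper_idealP => g h; rewrite !inE => /exists_inP[l lG lg] gh.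
by apply/exists_inP; exists l => //; apply: root_le_trans gh.
Qed.

(** Going up in the root order lowers left ends and raises right ends, so crossing is inherited from
    [G]. *)
Lemma abelian_ideal_upset G : crossing G -> abelian_ideal (upset G).
Proof.
move=> crG; apply/abelian_idealE; first exact: upper_ideal_upset.
move=> g h; rewrite !inE => /exists_inP[g' g'G +] /exists_inP[h' h'G].
by rewrite !root_leE; have := crG _ _ g'G h'G; lia.
Qed.

Lemma generators_upset G : antichain G -> generators (upset G) = G.
Proof.
move=> acG; apply/setP => g; rewrite !inE; apply/andP/idP => [[]|gG].
  move=> /exists_inP[h hG hg] /forall_inP/(_ h).
  rewrite inE hg => /(_ _)/eqP <- //.
  by apply/exists_inP; exists h; rewrite ?root_le_refl.
split; first by apply/exists_inP; exists g; rewrite ?root_le_refl.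
apply/forall_inP => h; rewrite inE => /exists_inP[l lG lh].
apply/implyP => hg; have lg := acG _ _ lG gG (root_le_trans lh hg).
by apply/eqP/root_le_anti => //; rewrite -lg.
Qed.

Lemma upset_generators I : upper_ideal I -> upset (generators I) = I.
Proof.
move=> /upper_idealP upI; apply/setP => h; rewrite inE.
apply/exists_inP/idP => [[g]|hI].
  by rewrite inE => /andP[gI _]; apply: upI.
pose P g := (g \in I) && root_le (val g) (val h).
have Ph : P h by rewrite /P hI root_le_refl.
(* A shortest root of [I] below [h] is a generator, as anything in [I] below it has the same
   length. *)
case: (arg_minnP (fun g => hi g - lo g) Ph) => g /andP[gI gh] gmin.
exists g => //; rewrite inE gI; apply/forall_inP => l lI; apply/implyP => lg.
have {gmin} := gmin l; rewrite /P lI (root_le_trans lg gh) => /(_ isT) gl.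
have := ltn_lo_hi l; have := ltn_lo_hi g; move: (lg); rewrite root_leE => *.
by apply/eqP/lo_hi_inj; apply: val_inj => /=; lia.
Qed.

Lemma antichain_generators I : antichain (generators I).
Proof.
move=> g h; rewrite !inE => /andP[gI _] /andP[_ /forall_inP/(_ g gI)].
by move=> /implyP hmin /hmin/eqP.
Qed.

Lemma crossing_generators I : abelian_ideal I -> crossing (generators I).
Proof.
move=> abI; have /andP[upI _] := abI; move/(abelian_idealE upI): abI => crI.
by move=> g h; rewrite !inE => /andP[gI _] /andP[hI _]; apply: crI.
Qed.

(** * Crossing antichains and their sets of endpoints *)

Definition endpoints G := lo @: G :|: hi @: G.

Section CrossingAntichain.
Variable G : {set pos_roots n}.
Hypotheses (acG : antichain G) (crG : crossing G).

(** Otherwise one interval would contain the other. *)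
Lemma ltn_lo_antichain : {in G &, forall g h, (lo g < lo h) = (hi g < hi h)}.
Proof.
move=> g h gG hG; apply/idP/idP => gh; rewrite ltnNge; apply/negP => hg.
  have hgE : h = g by apply: acG; rewrite // root_leE (ltnW gh).
  by rewrite hgE ltnn in gh.
have ghE : g = h by apply: acG; rewrite // root_leE hg ltnW.
by rewrite ghE ltnn in gh.
Qed.

Lemma lo_inj : {in G &, injective (@lo n)}.
Proof.
move=> g h gG hG gh; have [ghi|hgi] := leqP (hi g) (hi h).
  by apply: acG; rewrite // root_leE gh leqnn.
by apply/esym/acG; rewrite // root_leE gh leqnn ltnW.
Qed.

Lemma hi_inj : {in G &, injective (@hi n)}.
Proof.
move=> g h gG hG gh; have [ghi|hgi] := leqP (lo h) (lo g).
  by apply: acG; rewrite // root_leE gh leqnn andbT.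
by apply/esym/acG; rewrite // root_leE gh leqnn ltnW.
Qed.

Lemma disjoint_lo_hi : [disjoint lo @: G & hi @: G].
Proof.
apply/pred0P => e /=; apply/andP => -[/imsetP[g gG ->] /imsetP[h hG gh]].
by have := crG gG hG; rewrite gh ltnn.
Qed.

Lemma card_endpoints : #|endpoints G| = #|G|.*2.
Proof.
rewrite cardsU disjoint_setI0 ?disjoint_lo_hi // cards0 subn0.
by rewrite (card_in_imset lo_inj) (card_in_imset hi_inj) addnn.
Qed.

(* A node [k] is in [supp g] iff exactly one of the endpoints of [g] is
   [<= k]. *)
Lemma bigsymdiff_supp :
  \big[@symdiff 'I_n/set0]_(g in G) supp (val g) =
  [set k : 'I_n | parity (endpoints G) k].
Proof.
apply/setP => k; rewrite in_bigsymdiff inE /parity.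
rewrite (eq_bigl (fun e => (e \in lo @: G) || (e \in hi @: G))); last first.
  by move=> e; rewrite inE.
rewrite bigU ?disjoint_lo_hi //= (big_imset _ lo_inj) (big_imset _ hi_inj) /=.
rewrite -big_split; apply: eq_bigr => g _; rewrite in_supp /=.
by have := ltn_lo_hi g; lia.
Qed.

Lemma rank_endpoints m :
  rank (endpoints G) m =
  #|[set g in G | lo g < m]| + #|[set g in G | hi g < m]|.
Proof.
rewrite /rank -(card_in_imset (f := @lo n)); last first.
  by move=> g h; rewrite !inE => /andP[gG _] /andP[hG _]; apply: lo_inj.
rewrite -(card_in_imset (f := @hi n) (D := [set g in G | hi g < m])); last first.
  by move=> g h; rewrite !inE => /andP[gG _] /andP[hG _]; apply: hi_inj.
have sub_lo : lo @: [set g in G | lo g < m] \subset lo @: G.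
  by apply/imsetS/subsetP => g; rewrite inE => /andP[].
have sub_hi : hi @: [set g in G | hi g < m] \subset hi @: G.
  by apply/imsetS/subsetP => g; rewrite inE => /andP[].
rewrite -cardsUI (disjoint_setI0 _) ?cards0 ?addn0; last first.
  exact: disjointW sub_lo sub_hi disjoint_lo_hi.
apply: eq_card => e; rewrite !inE; apply/andP/orP.
  by move=> [/orP[]/imsetP[g gG ->] gm]; [left|right]; rewrite imset_f ?inE ?gG.
by move=> []/imsetP[g]; rewrite inE => /andP[gG gm] ->; split=> //;
  rewrite imset_f ?orbT.
Qed.

(** By crossing, all [#|G|] left ends lie below [hi g] and no right end lies below [lo g]; by the
    antichain condition, as many right ends precede [hi g] as left ends precede [lo g]. *)
Lemma rank_hi g : g \in G ->
  rank (endpoints G) (hi g) = rank (endpoints G) (lo g) + #|G|.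
Proof.
move=> gG; rewrite !rank_endpoints.
rewrite (_ : [set h in G | lo h < hi g] = G); last first.
  by apply/setP => h; rewrite inE andb_idr // => hG; apply: crG.
rewrite (_ : [set h in G | hi h < lo g] = set0) ?cards0 ?addn0; last first.
  apply/setP => h; rewrite !inE; apply/negP => /andP[hG].
  by have := crG gG hG; lia.
rewrite addnC; congr (_ + _); apply: eq_card => h; rewrite !inE.
by case: (boolP (h \in G)) => //= hG; rewrite ltn_lo_antichain.
Qed.

End CrossingAntichain.

(** For even [#|E|], this joins the i-th point of the lower half to the i-th point of the upper
    half. *)
Definition pairing E : {set pos_roots n} :=
  [set g | [&& lo g \in E, hi g \in E &
               rank E (hi g) == rank E (lo g) + #|E|./2]].

Lemma pairing_endpoints G :
  antichain G -> crossing G -> pairing (endpoints G) = G.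
Proof.
move=> acG crG; set E := endpoints G.
have halfE : #|E|./2 = #|G| by rewrite card_endpoints // doubleK.
have loE h : h \in G -> lo h \in E by move=> hG; rewrite inE imset_f.
have hiE h : h \in G -> hi h \in E by move=> hG; rewrite inE imset_f ?orbT.
apply/setP => g; rewrite inE halfE; apply/and3P/idP => [[]|gG]; last first.
  by rewrite loE ?hiE // rank_hi.
rewrite {1}inE => /orP[]/imsetP[h hG gh] higE; rewrite gh.
  rewrite -rank_hi // => /eqP/(rank_inj higE (hiE _ hG)) ghi.
  by rewrite (lo_hi_inj gh ghi).
(* If [lo g] were a right end, its rank would be at least [#|G|], and that of [hi g] at least
   [#|E|]. *)
rewrite (rank_hi acG crG hG) => /eqP rE; have := rank_ltn_card higE.
by rewrite rE card_endpoints // -/E; lia.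
Qed.

(** All pairs have the same rank difference, so nested ones have equal ranks at both ends. *)
Lemma antichain_pairing E : antichain (pairing E).
Proof.
move=> g h; rewrite !inE root_leE => /and3P[lg hg /eqP rg] /and3P[lh hh /eqP rh].
move=> /andP[/(leq_rank E) rlo /(leq_rank E) rhi].
by apply: lo_hi_inj; apply: (rank_inj (E := E)) => //; lia.
Qed.

(** Left ends have rank below [#|E|./2], right ends at least that. *)
Lemma crossing_pairing E : ~~ odd #|E| -> crossing (pairing E).
Proof.
move=> evenE g h; rewrite !inE => /and3P[lg hg /eqP rg] /and3P[lh hh /eqP rh].
rewrite -(ltn_rankE _ lg).
by have := rank_ltn_card hg; have := even_halfK evenE; lia.
Qed.

Lemma endpoints_pairing E : ~~ odd #|E| -> endpoints (pairing E) = E.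
Proof.
move=> evenE; have cardE := even_halfK evenE.
apply/eqP; rewrite eqEsubset; apply/andP; split.
  by apply/subsetP => e; rewrite inE => /orP[]/imsetP[g + ->];
    rewrite inE => /and3P[].
apply/subsetP => e eE; rewrite inE.
(* A point of the lower half is a left end, its partner being half of [#|E|] ranks higher; a point
   of the upper half is a right end, with its partner as many ranks lower. *)
have rE := rank_ltn_card eE; have [re|re] := ltnP (rank E e) #|E|./2.
  have [|f fE rf] := @ex_rank _ E (rank E e + #|E|./2); first by lia.
  have [|g ge gf] := @ex_pos_root _ e f; first by rewrite -(ltn_rankE _ eE); lia.
  by rewrite -{1}ge imset_f // inE ge gf eE fE rf /=.
have [|f fE rf] := @ex_rank _ E (rank E e - #|E|./2); first by lia.
have [|g gf ge] := @ex_pos_root _ f e; first by rewrite -(ltn_rankE _ fE); lia.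
by rewrite -{2}ge imset_f ?orbT // inE ge gf eE fE rf subnK /=.
Qed.

End Ideals.

(** * The inverse of [Phi] and the number of components *)

Section Bijection.
Variable n : nat.

Lemma boundary_Phi (I : Ab n) :
  boundary (Phi I) = endpoints (generators (val I)).
Proof.
have acI := antichain_generators (I := val I).
have crI := crossing_generators (valP I).
rewrite /Phi bigsymdiff_supp // boundary_parity //.
by rewrite card_endpoints // odd_double.
Qed.

Definition ideal_of (S : {set 'I_n}) : Ab n :=
  Sub (upset (pairing (boundary S)))
      (abelian_ideal_upset (crossing_pairing (even_boundary S))).

Lemma PhiK : cancel (@Phi n) ideal_of.
Proof.
move=> I; apply: val_inj; rewrite SubK boundary_Phi pairing_endpoints.
- by rewrite upset_generators //; case/andP: (valP I).
- exact: antichain_generators.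
- exact: crossing_generators (valP I).
Qed.

Lemma ideal_ofK : cancel ideal_of (@Phi n).
Proof.
move=> S; rewrite /Phi SubK generators_upset; last exact: antichain_pairing.
have crS := crossing_pairing (even_boundary S).
rewrite bigsymdiff_supp; [|exact: antichain_pairing|exact: crS].
rewrite endpoints_pairing ?even_boundary //; apply/setP => k.
by rewrite inE parity_boundary ?node_in_ord // ltnW.
Qed.

(** Both numbers are half the size of the boundary of [Phi I], which is the set of endpoints of the
    generators. *)
Lemma card_components_Phi (I : Ab n) :
  #|components (Phi I)| = #|generators (val I)|.
Proof.
apply: double_inj; rewrite card_components -card_boundary boundary_Phi.
by rewrite card_endpoints //; [exact: antichain_generators
  |exact: crossing_generators (valP I)].
Qed.
End Bijection.

Theorem theorem2p1 (n : nat) :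
  bijective (@Phi n) /\
  (forall (I : Ab n) (k : nat),
     #|generators (val I)| = k -> #|components (Phi I)| = k).
Proof.
split; first by exists (@ideal_of n); [exact: PhiK|exact: ideal_ofK].
by move=> I k <-; apply: card_components_Phi.
Qed.
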